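(* There exists a 2NPDA $\mathcal A_0$ over an input alphabet $\Sigma_0$ with the following property: for every finite alphabet $\Sigma$ and every 2NPDA $\mathcal A$ over $\Sigma$ there is a homomorphism $h\colon\Sigma^*\to\Sigma_0^*$ such that, for all $w\in\Sigma^+$, $w\in L(\mathcal A)$ if and only if $h(w)\in L(\mathcal A_0)$.
   Context: 2NPDA (two-way nondeterministic pushdown automaton) over a finite input alphabet $\Sigma$ (here $\Sigma$ does not include the tape endmarkers $\lhd,\rhd$): $\mathcal A=(Q,\Sigma\cup\{\lhd,\rhd\},\Gamma,\delta,q_0,F)$ with finite set of states $Q$, finite stack alphabet $\Gamma$, initial state $q_0\in Q$, final states $F\subseteq Q$, and finite transition relation $\delta\subseteq Q\times(\Sigma\cup\{\lhd,\rhd\})\times\Gamma\times Q\times\Gamma^*\times\{-1,0,+1\}$. $\Gamma$ contains a designated end-of-stack symbol $Z_0$ which is always kept at the bottom of the stack: transitions never remove or replace it and never push another copy of it. A configuration is $(q,w\hat a x,\gamma)$ with $q\in Q$, tape content $wax$, the hat marking the scanned letter, and stack $\gamma\in\Gamma^*$ (top at the left). There is a step $(q_1,a_1\ldots\hat a_i\ldots a_m,Z\gamma)\to(q_2,a_1\ldots\hat a_j\ldots a_m,\gamma'\gamma)$ whenever $(q_1,a_i,Z,q_2,\gamma',d)\in\delta$ and $j=i+d\in\{1,\ldots,m\}$. A word $w\in\Sigma^*$ is accepted if $(q_0,\hat{\lhd}w\rhd,Z_0)\to^*(q,\lhd w\hat{\rhd},Z_0)$ for some $q\in F$; $L(\mathcal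 A)\subseteq\Sigma^*$ is the set of accepted words. A homomorphism $h\colon\Sigma^*\to\Sigma_0^*$ is a mapping with $h(uv)=h(u)h(v)$ for all $u,v\in\Sigma^*$. *)

(* Defs.v *)
From HB Require Import structures.
From mathcomp Require Import all_boot all_order all_algebra.
From Stdlib Require Import Relation_Operators.
Set Implicit Arguments.
Unset Strict Implicit.
Unset Printing Implicit Defensive.

Local Open Scope ring_scope.

(* The disjoint sum keeps the two endmarkers outside the input alphabet. *)
Definition tape_symbol (Sigma : finType) : finType := (Sigma + bool)%type.

Definition lmark {Sigma : finType} : tape_symbol Sigma := inr false.
Definition rmark {Sigma : finType} : tape_symbol Sigma := inr true.
Definition letter {Sigma : finType} (a : Sigma) : tape_symbol Sigma := inl a.

(* Two-way nondeterministic pushdown automata.  The set of transitions is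
   finite because it is the set of members of a list.  Pushed words are written
   with the top of the stack first, so a transition that reads the end-of-stack
   symbol must push a word whose only occurrence of it is the last symbol. *)
Record npda2 (Sigma : finType) := Npda2 {
  state : finType;
  stack_symbol : finType;
  bottom : stack_symbol;
  init : state;
  final : {set state};
  delta : seq (state * tape_symbol Sigma * stack_symbol
               * state * seq stack_symbol * int);
  delta_move : forall q1 a Z q2 g d,
    (q1, a, Z, q2, g, d) \in delta -> d \in [:: -1; 0; 1];
  delta_bottom : forall q1 a q2 g d,
    (q1, a, bottom, q2, g, d) \in delta ->
    exists2 g', g = rcons g' bottom & bottom \notin g';
  delta_not_bottom : forall q1 a Z q2 g d,
    Z != bottom -> (q1, a, Z, q2, g, d) \in delta -> bottom \notin g
}.

(* The tape is read-only, so it is a parameter of the step relation, and a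
   configuration holds the state, the head position (counted from 0) and the
   stack (top first). *)
Definition config (Sigma : finType) (A : npda2 Sigma) : Type :=
  (state A * nat * seq (stack_symbol A))%type.

Inductive step (Sigma : finType) (A : npda2 Sigma)
    (t : seq (tape_symbol Sigma)) : config A -> config A -> Prop :=
  Step q1 a Z q2 g' d (i j : nat) g of
    (q1, a, Z, q2, g', d) \in delta A
    & onth t i = Some a & (j < size t)%N & j%:Z = i%:Z + d :
    step t (q1, i, Z :: g) (q2, j, g' ++ g).

Definition tape_of (Sigma : finType) (w : seq Sigma) : seq (tape_symbol Sigma) :=
  lmark :: rcons (map letter w) rmark.

Definition accepts (Sigma : finType) (A : npda2 Sigma) (w : seq Sigma) : Prop :=
  exists2 q, q \in final A &
    clos_refl_trans (config A) (step (tape_of w))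
      (init A, 0%N, [:: bottom A]) (q, (size w).+1, [:: bottom A]).

Definition word_morphism (Sigma Sigma0 : finType)
    (h : seq Sigma -> seq Sigma0) : Prop :=
  {morph h : u v / u ++ v}.

(* Main.v *)
(* The universal automaton keeps the code of the state of A and of the stack of
   A, all in unary, on its own stack.  Transitions are encoded as programs that
   pop the code of (state, top symbol) and push the code of the new state and
   of the pushed word; the image of a letter is the list of the programs of all
   transitions on that letter and of all transitions on the two endmarkers.
   The machine guesses a program, runs it from left to right, which gets stuck
   unless the transition is applicable, and then stays in its block or moves to
   a neighbouring one.
   A visit of A to an endmarker is simulated in the adjacent block, and the
   finite control only remembers that the endmarker is meant. *)
From HB Require Import structures.
Require Import Defs.
From mathcomp Require Import all_boot all_algebra zify.
From Stdlib Require Import Relation_Operators Operators_Properties.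
Set Implicit Arguments.
Unset Strict Implicit.
Unset Printing Implicit Defensive.

(** * Head moves as optional directions *)

Definition move_int (m : option bool) : int :=
  match m with None => 0%R | Some true => 1%R | Some false => (-1)%R end.

Definition moves (m : option bool) (p p' : nat) : Prop :=
  match m with
  | None => p' = p
  | Some true => p' = p.+1
  | Some false => p = p'.+1
  end.

Lemma moves_int m p p' :
  moves m p p' <-> Posz p' = (Posz p + move_int m)%R.
Proof. by case: m => [[]|] /=; lia. Qed.

Definition move_of_int (d : int) : option bool :=
  if d == 0%R then None else Some (d == 1%R).

Lemma move_of_intK d :
  d \in [:: (-1)%R; 0%R; 1%R] -> move_int (move_of_int d) = d.
Proof. by rewrite !inE => /or3P[]/eqP->. Qed.

Lemma move_int_mem m : move_int m \in [:: (-1)%R; 0%R; 1%R].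
Proof. by case: m => [[]|]. Qed.

(** * Automata whose stack holds bits above the end-of-stack symbol *)

Section BitMachine.

Variables (L Q : finType) (q0 : Q) (F : {set Q}).

(* An instruction [(q, (u, v), m)] replaces the bits [u] on top of the stack by
   [v], whatever the rest of the stack is. *)
Variable instr :
  Q -> tape_symbol L -> seq (Q * (option bool * seq bool) * option bool).

(** The stack alphabet is [option bool] with [None] at the bottom. A step of a 2NPDA always consumes
    the top symbol, so an instruction that pops nothing yields one transition for each [Z], which
    puts [Z] back below the pushed bits. *)
Definition rewrite_top (uv : option bool * seq bool) (Z : option bool) :
    seq (seq (option bool)) :=
  if uv.1 is Some _ then
    if Z == uv.1 then [:: map Some uv.2] else [::]
  else [:: rcons (map Some uv.2) Z].

Definition bit_delta :=
  [seq (x.1.1, x.1.2, x.2, y.1.1.1, y.2, move_int y.1.2) |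
     x <- enum {: Q * tape_symbol L * option bool},
     y <- [seq (r, g) | r <- instr x.1.1 x.1.2, g <- rewrite_top r.1.2 x.2]].

Lemma bit_deltaP q1 a Z q2 g d :
  reflect (exists uv m, [/\ (q2, uv, m) \in instr q1 a, g \in rewrite_top uv Z
                          & d = move_int m])
          ((q1, a, Z, q2, g, d) \in bit_delta).
Proof.
apply: (iffP allpairsPdep) => [[x][y][_ /allpairsPdep[[[q uv] m]][g']]|].
  by case=> ? ? -> [-> -> -> -> -> ->]; exists uv, m.
case=> uv [m [instr_m mem_g ->]].
exists (q1, a, Z), ((q2, uv, m), g); split=> //=; first by rewrite mem_enum.
by apply/allpairsPdep; exists (q2, uv, m), g.
Qed.

Lemma bit_delta_move q1 a Z q2 g d :
  (q1, a, Z, q2, g, d) \in bit_delta -> d \in [:: (-1)%R; 0%R; 1%R].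
Proof. by case/bit_deltaP=> uv [m [_ _ ->]]; apply: move_int_mem. Qed.

Lemma None_notin_map_Some (v : seq bool) : None \notin map Some v.
Proof. by apply/mapP=> -[]. Qed.

Lemma bit_delta_bottom q1 a q2 g d :
  (q1, a, None, q2, g, d) \in bit_delta ->
  exists2 g', g = rcons g' None & None \notin g'.
Proof.
case/bit_deltaP=> -[[b|] v] [m [_ + _]] //=; rewrite inE => /eqP->.
by exists (map Some v) => //; apply: None_notin_map_Some.
Qed.

Lemma bit_delta_not_bottom q1 a Z q2 g d :
  Z != None -> (q1, a, Z, q2, g, d) \in bit_delta -> None \notin g.
Proof.
case: Z => // c _ /bit_deltaP[[[b|] v] [m [_ + _]]]; rewrite /rewrite_top /=.
  by case: eqP => // _; rewrite inE => /eqP->; apply: None_notin_map_Some.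
by rewrite inE => /eqP->; rewrite mem_rcons inE None_notin_map_Some.
Qed.

Definition bit_machine : npda2 L :=
  Npda2 q0 F bit_delta_move bit_delta_bottom bit_delta_not_bottom.

Definition bits_stack (v : seq bool) : seq (option bool) :=
  rcons (map Some v) None.

Lemma bits_stack_inj : injective bits_stack.
Proof.
by move=> u v /rcons_inj[/inj_map]; apply; apply: Some_inj.
Qed.

Variant bit_step (t : seq (tape_symbol L)) :
    Q * nat * seq bool -> Q * nat * seq bool -> Prop :=
  BitStep q p v q' p' v' r a u m of
    onth t p = Some a & (q', (u, v'), m) \in instr q a & v = seq_of_opt u ++ r
    & moves m p p' & p' < size t : bit_step t (q, p, v) (q', p', v' ++ r).

(** Inversion at a position whose letter is known: only the members of [instr q a] remain to be
    examined, a list that computes for a concrete machine. *)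
Lemma bit_step_ind_at t q p v a (P : Q * nat * seq bool -> Prop) :
  onth t p = Some a ->
  (forall q' u v' m r p', (q', (u, v'), m) \in instr q a ->
     v = seq_of_opt u ++ r -> moves m p p' -> P (q', p', v' ++ r)) ->
  forall c, bit_step t (q, p, v) c -> P c.
Proof.
move=> ta P_next c st; move: {-2}(q, p, v) (erefl (q, p, v)) st => c0 + st.
case: st => {c c0} q1 p1 v1 q2 p2 v2 r a1 u m ta1 qm def_v mv _ [eq_q eq_p eq_v].
move: mv; rewrite eq_p; apply: (P_next _ u); last by rewrite -eq_v.
by move: ta1 qm; rewrite eq_q eq_p ta => -[<-].
Qed.

Definition bit_config (c : Q * nat * seq bool) : config bit_machine :=
  (c.1.1, c.1.2, bits_stack c.2).

Lemma bit_config_inj : injective bit_config.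
Proof. by move=> [[q p] v] [[q' p'] v'] [-> -> /bits_stack_inj->]. Qed.

Lemma step_bit_config t c c' :
  bit_step t c c' -> step t (bit_config c) (bit_config c').
Proof.
case=> q p v q' p' v' r a u m ta qm -> /moves_int mv lt_p'.
rewrite /bit_config /=.
have -> : bits_stack (v' ++ r) = map Some v' ++ bits_stack r.
  by rewrite /bits_stack map_cat rcons_cat.
case: u qm => [b|] qm /=.
  apply: (@Step _ bit_machine) ta lt_p' mv.
  by apply/bit_deltaP; exists (Some b, v'), m; rewrite /rewrite_top eqxx inE.
(* The stack ends with [None], so there is a top symbol [Z] to read and restore. *)
case def_r: (bits_stack r) => [|Z g]; first by case: (r) def_r.
rewrite -cat_rcons.
apply: (@Step _ bit_machine) ta lt_p' mv.
by apply/bit_deltaP; exists (None, v'), m; rewrite /rewrite_top inE.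
Qed.

Lemma step_bit_configE t c d :
  step t (bit_config c) d -> exists2 c', bit_step t c c' & d = bit_config c'.
Proof.
case: c => -[q p] v; rewrite /bit_config /=.
move: (erefl (q, p, bits_stack v : seq (stack_symbol bit_machine))).
move: {-2}(_, _, _) => c eq_c st; case: st eq_c => {c d}.
move=> q1 a Z q2 g' d i j g /bit_deltaP[[u v'] [m [qm g'm ->]]] ta lt_j.
move/moves_int=> mv; move: g'm; case: u qm => [b|] qm; rewrite /rewrite_top /=.
  case: (Z =P Some b) => // ->; rewrite inE => /eqP-> [<- <-].
  case: v => [|c v] //= [<- ->]; exists (q2, j, v' ++ v).
    exact: BitStep ta qm _ mv lt_j.
  by rewrite /bit_config /bits_stack /= map_cat rcons_cat.
rewrite inE => /eqP-> [<- <-] eq_v; exists (q2, j, v' ++ v).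
  exact: BitStep ta qm _ mv lt_j.
by rewrite /bit_config /= cat_rcons eq_v /bits_stack map_cat rcons_cat.
Qed.

(** Steps of the two kinds correspond under [bit_config], and a step from the image of [bit_config]
    stays in it; hence a run can be pulled back step by step from its first configuration. *)
Lemma accepts_bit_machine w :
  accepts bit_machine w <->
  exists2 q, q \in F &
    clos_refl_trans _ (bit_step (tape_of w)) (q0, 0, [::]) (q, (size w).+1, [::]).
Proof.
pose b0 : config bit_machine := bit_config (q0, 0, [::]).
split=> -[q Fq runs]; exists q => //.
  pose b1 : config bit_machine := bit_config (q, (size w).+1, [::]).
  have {}runs : clos_refl_trans_1n _ (step (tape_of w)) b0 b1 by exact/clos_rt_rt1n.
  move: {-2}b0 (erefl b0) {-2}b1 (erefl b1) runs; rewrite {1}/b0 {1}/b1.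
  move: (q0, _, _) (q, _, _) => c c' d def_d d' def_d' runs.
  elim: runs c def_d def_d' => {d d'} [d c -> /bit_config_inj->|]; first exact: rt_refl.
  move=> d d1 d' st _ IH c def_d def_d'; rewrite def_d in st.
  have [c1 st1 def_d1] := step_bit_configE st.
  by apply: rt_trans (IH c1 _ def_d') => //; apply: rt_step.
have sim c c' : clos_refl_trans _ (bit_step (tape_of w)) c c' ->
    clos_refl_trans (config bit_machine) (step (tape_of w))
      (bit_config c) (bit_config c').
  elim=> {c c'} [c c' st|c|c1 c2 c3 _ st1 _ st2].
  - exact/rt_step/step_bit_config.
  - exact: rt_refl.
  - exact: rt_trans st1 st2.
exact: sim runs.
Qed.

End BitMachine.

(** * The universal automaton *)

(* [Outside b] stands for the endmarker [inr b]; [Start] is left at once by the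
   program that pushes the initial configuration. *)
Inductive mode := Start | Inside | Outside of bool.

Definition mode_code (m : mode) : option (option bool) :=
  match m with
  | Start => None | Inside => Some None | Outside b => Some (Some b)
  end.
Definition mode_decode (c : option (option bool)) : mode :=
  match c with
  | None => Start | Some None => Inside | Some (Some b) => Outside b
  end.
Lemma mode_codeK : cancel mode_code mode_decode. Proof. by case. Qed.
HB.instance Definition _ := Finite.copy mode (can_type mode_codeK).

(* [Stuck] ends the programs of the transitions that would leave the tape. *)
Inductive action := Goto of mode | Leave of bool | Finish | Stuck.

Definition action_code (e : action) : mode + bool + bool :=
  match e with
  | Goto m => inl (inl m) | Leave b => inl (inr b)
  | Finish => inr true | Stuck => inr false
  end.
Definition action_decode (c : mode + bool + bool) : action :=
  match c with
  | inl (inl m) => Goto m | inl (inr b) => Leave b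
  | inr true => Finish | inr false => Stuck
  end.
Lemma action_codeK : cancel action_code action_decode. Proof. by case. Qed.
HB.instance Definition _ := Finite.copy action (can_type action_codeK).

(** [Edge false] and [Edge true] delimit a block. Inside it, each program starts with an [Enter m],
    naming the mode in which it may be chosen, and closes with an [End]. *)
Inductive uletter :=
  Edge of bool | Enter of mode | Pop of bool | Push of bool | End of action.

Definition uletter_code (x : uletter) : bool + mode + bool + bool + action :=
  match x with
  | Edge b => inl (inl (inl (inl b))) | Enter m => inl (inl (inl (inr m)))
  | Pop b => inl (inl (inr b)) | Push b => inl (inr b) | End e => inr e
  end.
Definition uletter_decode (c : bool + mode + bool + bool + action) : uletter :=
  match c with
  | inl (inl (inl (inl b))) => Edge b | inl (inl (inl (inr m))) => Enter m
  | inl (inl (inr b)) => Pop b | inl (inr b) => Push b | inr e => End e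
  end.
Lemma uletter_codeK : cancel uletter_code uletter_decode. Proof. by case. Qed.
HB.instance Definition _ := Finite.copy uletter (can_type uletter_codeK).

(** [Roam m] looks for a program within one block, [Exec] runs it, [Cross b] travels to the
    neighbouring block in direction [b], and [Halt] runs to the right endmarker. *)
Inductive ustate := Roam of mode | Exec | Cross of bool | Halt.

Definition ustate_code (q : ustate) : mode + bool + bool :=
  match q with
  | Roam m => inl (inl m) | Cross b => inl (inr b)
  | Exec => inr true | Halt => inr false
  end.
Definition ustate_decode (c : mode + bool + bool) : ustate :=
  match c with
  | inl (inl m) => Roam m | inl (inr b) => Cross b
  | inr true => Exec | inr false => Halt
  end.
Lemma ustate_codeK : cancel ustate_code ustate_decode. Proof. by case. Qed.
HB.instance Definition _ := Finite.copy ustate (can_type ustate_codeK).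

(* Since every block has the form [Edge false ... Edge true], a machine in state
   [Cross b] that meets [Edge (~~ b)] has just entered the next block, and one
   that meets an endmarker has just left the last block in direction [b]. *)
Definition uinstr (q : ustate) (a : tape_symbol uletter) :
    seq (ustate * (option bool * seq bool) * option bool) :=
  let keep q m := (q, (None, [::]), m) in
  match q, a with
  | Roam m, inr b | Roam m, inl (Edge b) => [:: keep (Roam m) (Some (~~ b))]
  | Roam m, inl x =>
      (if x == Enter m then [:: keep Exec (Some true)] else [::])
      ++ [:: keep (Roam m) (Some true); keep (Roam m) (Some false)]
  | Exec, inl (Pop b) => [:: (Exec, (Some b, [::]), Some true)]
  | Exec, inl (Push b) => [:: (Exec, (None, [:: b]), Some true)]
  | Exec, inl (End (Goto m)) => [:: keep (Roam m) None]
  | Exec, inl (End (Leave b)) => [:: keep (Cross b) None]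
  | Exec, inl (End Finish) => [:: keep Halt (Some true)]
  | Cross b, inl (Edge b') =>
      if b == b' then [:: keep (Cross b) (Some b)]
      else [:: keep (Roam Inside) None]
  | Cross b, inl _ => [:: keep (Cross b) (Some b)]
  | Cross b, inr _ => [:: keep (Roam (Outside b)) (Some (~~ b))]
  | Halt, inl _ => [:: keep Halt (Some true)]
  | _, _ => [::]
  end.

Definition universal : npda2 uletter :=
  bit_machine (Roam Start) [set Halt] uinstr.

(** * Codes, programs and blocks *)

Definition code (T : finType) (x : T) : seq bool :=
  rcons (nseq (enum_rank x) true) false.

(** Unary numbers closed by [false] form a prefix code over an alphabet that does not depend on
    [T]. *)
Lemma code_cat_inj (T : finType) (x y : T) r s :
  code x ++ r = code y ++ s -> x = y /\ r = s.
Proof.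
have unary m n : nseq m true ++ false :: r = nseq n true ++ false :: s ->
    m = n /\ r = s.
  by elim: m n => [|m IH] [|n] //= []; last by move/IH=> [-> ->].
by rewrite /code !cat_rcons => /unary[/val_inj/enum_rank_inj].
Qed.

Definition item : Type := mode * (seq bool * seq bool) * action.

(** Bits are pushed one at a time, hence the reversal: the first bit of [uv.2] must end on top. *)
Definition program (uv : seq bool * seq bool) : seq uletter :=
  map Pop uv.1 ++ map Push (rev uv.2).

Definition item_word (it : item) : seq uletter :=
  Enter it.1.1 :: rcons (program it.1.2) (End it.2).

Definition block_of (its : seq item) : seq uletter :=
  Edge false :: rcons (flatten (map item_word its)) (Edge true).

Variant cell_spec (b : seq uletter) (o : nat) : uletter -> Prop :=
| LeftEdge of o = 0 : cell_spec b o (Edge false)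
| RightEdge of o.+1 = size b : cell_spec b o (Edge true)
| Interior x of 0 < o & o.+1 < size b & (forall e, x != Edge e) :
    cell_spec b o x.

(** Edges occur only at the two ends of a block, so the scanned letter alone tells whether the head
    can move either way without leaving the block. *)
Lemma cellP its o : o < size (block_of its) ->
  cell_spec (block_of its) o (nth (Edge true) (block_of its) o).
Proof.
rewrite {1}/block_of /= size_rcons; case: o => [|o]; first by move=> _; apply: LeftEdge.
rewrite !ltnS leq_eqVlt => /predU1P[->|lt_o].
  rewrite /= nth_rcons ltnn eqxx.
  by apply: RightEdge; rewrite /= size_rcons.
rewrite /= nth_rcons lt_o; apply: Interior; rewrite //= ?size_rcons //.
move=> e; apply/eqP=> def_e; have := mem_nth (Edge true) lt_o.
rewrite {}def_e => /flatten_mapP[it _]; rewrite inE mem_rcons inE mem_cat.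
by case/or4P=> [/eqP|/eqP|/mapP[]|/mapP[]].
Qed.

(** Inside an item word only the first letter is an [Enter], so a guess of the machine always starts
    a complete program. *)
Lemma enter_item its o m : nth (Edge true) (block_of its) o = Enter m ->
  exists it rest, [/\ it \in its, it.1.1 = m &
    drop o.+1 (block_of its) = program it.1.2 ++ End it.2 :: rest].
Proof.
rewrite /block_of; case: o => [|o] //=.
elim: its o => [|it its IH] o; first by case: o => [|[]].
rewrite -[map _ (it :: its)]/(item_word it :: _) -[flatten (_ :: _)]/(_ ++ _).
rewrite rcons_cat nth_cat; case: ltnP => [|le_o /IH].
  case: o => [_ [<-]|o /=].
    exists it, (rcons (flatten (map item_word its)) (Edge true)).
    by split; rewrite ?mem_head //= drop0 cat_rcons.
  rewrite ltnS => /(mem_nth (Edge true)) + def_o; rewrite def_o.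
  by rewrite mem_rcons inE mem_cat => /or3P[/eqP|/mapP[]|/mapP[]].
case=> it' [rest [its_it' <- def_rest]]; exists it', rest.
by rewrite inE its_it' orbT drop_cat ltnNge leqW //= subSn.
Qed.

Lemma item_offset its it : it \in its ->
  exists o rest, o < size (block_of its) /\
                 drop o (block_of its) = item_word it ++ rest.
Proof.
case/splitPr=> s1 s2; exists (size (flatten (map item_word s1))).+1.
exists (rcons (flatten (map item_word s2)) (Edge true)).
rewrite /block_of map_cat flatten_cat /= !(size_rcons, size_cat) /=; split; first by lia.
by rewrite rcons_cat drop_size_cat //= rcons_cat.
Qed.

(** * Tape positions in a concatenation of blocks *)

Section Blocks.

Variables (L : finType) (x0 : L) (bs : seq (seq L)).

(** The successor accounts for the left endmarker; for [k = size bs] this is the position of the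
    right endmarker. *)
Definition offset (k : nat) : nat := (size (flatten (take k bs))).+1.

Lemma offset0 : offset 0 = 1. Proof. by rewrite /offset take0. Qed.

Lemma offsetS k : k < size bs -> offset k.+1 = offset k + size (nth [::] bs k).
Proof.
by move=> lt_k; rewrite /offset (take_nth [::]) // flatten_rcons size_cat addSn.
Qed.

Lemma offset_size : offset (size bs) = (size (flatten bs)).+1.
Proof. by rewrite /offset take_size. Qed.

Lemma size_tape (w : seq L) : size (tape_of w) = (size w).+2.
Proof. by rewrite /= size_rcons size_map. Qed.

Lemma onth_lmark (w : seq L) : onth (tape_of w) 0 = Some lmark.
Proof. by []. Qed.

Lemma onth_rmark (w : seq L) : onth (tape_of w) (size w).+1 = Some rmark.
Proof. by rewrite /= -cats1 onth_cat size_map ltnn subnn. Qed.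

Lemma onth_letter (w : seq L) i :
  i < size w -> onth (tape_of w) i.+1 = Some (letter (nth x0 w i)).
Proof.
move=> lt_i; rewrite /= -cats1 onth_cat size_map lt_i onth_map.
by rewrite onthE (nth_map x0).
Qed.

Lemma onth_offset k o : k < size bs -> o < size (nth [::] bs k) ->
  onth (tape_of (flatten bs)) (offset k + o)
    = Some (letter (nth x0 (nth [::] bs k) o)).
Proof.
move=> lt_k lt_o; rewrite /offset addSn.
have def_bs : flatten bs = flatten (take k bs) ++ (nth [::] bs k ++ flatten (drop k.+1 bs)).
  by rewrite -{1}(cat_take_drop k bs) (drop_nth [::]) // flatten_cat.
rewrite onth_letter; last by rewrite def_bs !size_cat ltn_add2l ltn_addr.
by rewrite {1}def_bs nth_cat ltnNge leq_addr addKn nth_cat lt_o.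
Qed.

End Blocks.

(** * The homomorphism attached to a given automaton *)

Section Simulation.

Variables (Sigma : finType) (A : npda2 Sigma).

Definition enc (q : state A) (g : seq (stack_symbol A)) : seq bool :=
  code q ++ flatten (map (@code _) g).

Lemma enc_inj q q' g g' : enc q g = enc q' g' -> q = q' /\ g = g'.
Proof.
case/code_cat_inj=> -> eq_g; split=> //; elim: g g' eq_g => [|Z g IH] [|Z' g'] //=.
- by rewrite /code cat_rcons; case: (nseq _ _).
- by rewrite /code cat_rcons; case: (nseq _ _).
- by case/code_cat_inj=> -> /IH->.
Qed.

Definition zone (x : tape_symbol Sigma) : mode :=
  if x is inr b then Outside b else Inside.

(** An endmarker is visited from within its adjacent block, so stepping inward from it changes only
    the mode, and stepping outward is impossible. *)
Definition exit (x : tape_symbol Sigma) (d : option bool) : action :=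
  match x, d with
  | _, None => Goto (zone x)
  | inl _, Some b => Leave b
  | inr b, Some b' => if b == b' then Stuck else Goto Inside
  end.

Definition transition_item
    (tr : state A * tape_symbol Sigma * stack_symbol A
          * state A * seq (stack_symbol A) * int) : item :=
  let: (q1, x, Z, q2, g, d) := tr in
  (zone x, (enc q1 [:: Z], enc q2 g), exit x (move_of_int d)).

(** A homomorphism cannot tell the first or last letter of a word, so every block carries the
    starting, endmarker and accepting programs; the mode prevents their use in the wrong block. An
    accepting program pops the code of a final state and of the bare end-of-stack symbol of [A]. *)
Definition items (a : Sigma) : seq item :=
  (Start, ([::], enc (init A) [:: bottom A]), Goto (Outside false))
  :: [seq (Outside true, (enc q [:: bottom A], [::]), Finish) | q <- enum (final A)]
  ++ [seq transition_item tr | tr <- delta A & 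
        if tr.1.1.1.1.2 is inl a' then a' == a else true].

Definition block (a : Sigma) : seq uletter := block_of (items a).

Definition encode (w : seq Sigma) : seq uletter := flatten (map block w).

Lemma size_block a : 1 < size (block a).
Proof. by rewrite /= size_rcons. Qed.

Variables (a0 : Sigma) (w : seq Sigma).
(** Visits to the endmarkers need an adjacent block in which to take place. *)
Hypothesis w_gt0 : 0 < size w.

Let blk i := block (nth a0 w i).
Let off := offset (map block w).
Let tape := tape_of w.
Let utape := tape_of (encode w).

Lemma off0 : off 0 = 1. Proof. exact: offset0. Qed.

Lemma offS i : i < size w -> off i.+1 = off i + size (blk i).
Proof. by move=> lt_i; rewrite /off offsetS ?size_map // (nth_map a0). Qed.

Lemma off_size : off (size w) = (size (encode w)).+1.
Proof. by rewrite -offset_size size_map. Qed.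

Lemma onth_utape i o : i < size w -> o < size (blk i) ->
  onth utape (off i + o) = Some (letter (nth (Edge true) (blk i) o)).
Proof.
move=> lt_i lt_o; have def_b : nth [::] (map block w) i = blk i by rewrite (nth_map a0).
by rewrite -def_b /utape /encode (onth_offset (Edge true)) ?size_map ?def_b.
Qed.

Lemma lt_utape i o : i < size w -> o < size (blk i) -> off i + o < size utape.
Proof. by move=> lt_i lt_o; rewrite -onthTE onth_utape. Qed.

(** * Soundness: an invariant of the universal runs *)

Definition reach c := clos_refl_trans _ (step tape) (init A, 0, [:: bottom A]) c.

Definition coded (j : nat) (v : seq bool) : Prop :=
  exists q g, v = enc q g /\ reach (q, j, g).

(** The prefix code forces the coded configuration to have state [q1] and top symbol [Z], and [r] to
    code the rest of its stack; the transition therefore applies to it. *)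
Lemma coded_step q1 x Z q2 g d j j' r :
  (q1, x, Z, q2, g, d) \in delta A -> onth tape j = Some x ->
  moves (move_of_int d) j j' -> j' < (size w).+2 ->
  coded j (enc q1 [:: Z] ++ r) -> coded j' (enc q2 g ++ r).
Proof.
move=> tr tx mv lt_j' [q [G [def_v reach_c]]].
move: def_v; rewrite /enc /= cats0 -!catA => def_v.
case: G reach_c def_v => [|Z' G] reach_c.
  move=> /code_cat_inj[_]; rewrite /code cat_rcons.
  by case: (nseq _ _).
move=> /code_cat_inj[eq_q /code_cat_inj[eq_Z ->]].
exists q2, (g ++ G); rewrite /enc map_cat flatten_cat; split=> //.
apply: rt_trans reach_c _; apply: rt_step.
rewrite -eq_q -eq_Z; apply: (Step _ tr tx); first by rewrite size_tape.
by rewrite (proj1 (moves_int _ _ _) mv) move_of_intK // (delta_move tr).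
Qed.

(* [configured m i v]: when the universal machine roams over block [i] in mode
   [m], the bits [v] are the code of a configuration that [A] can reach. *)
Definition configured (m : mode) (i : nat) (v : seq bool) : Prop :=
  match m with
  | Start => i = 0 /\ v = [::]
  | Inside => coded i.+1 v
  | Outside false => i = 0 /\ coded 0 v
  | Outside true => i.+1 = size w /\ coded (size w).+1 v
  end.

(** Block [i] stands for position [i.+1] on the tape of [A]; these are the two neighbouring
    positions. *)
Definition target (i : nat) (b : bool) : nat := if b then i.+2 else i.

Definition outcome (e : action) (i : nat) (v : seq bool) : Prop :=
  match e with
  | Goto m => configured m i v
  | Leave b => coded (target i b) v
  | Finish => v = [::] -> accepts A w
  | Stuck => True
  end.

(** The starting item yields the initial configuration; an accepting item that leaves no bits has
    popped a whole accepting configuration, by [enc_inj]; a transition item not ending in [Stuck]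
    performs a step of [A]. *)
Lemma item_outcome i it r : i < size w -> it \in items (nth a0 w i) ->
  configured it.1.1 i (it.1.2.1 ++ r) -> outcome it.2 i (it.1.2.2 ++ r).
Proof.
move=> lt_i; rewrite inE => /predU1P[-> /= [-> ->]|].
  by rewrite cats0; split=> //; exists (init A), [:: bottom A]; split=> //; apply: rt_refl.
rewrite mem_cat => /orP[/mapP[q + ->] /= [_ [q' [g [def_v reach_c]]] r0]|].
  rewrite mem_enum => Fq; move: def_v; rewrite r0 cats0 => /enc_inj[eq_q eq_g].
  by exists q => //; move: reach_c; rewrite -eq_g -eq_q.
case/mapP=> -[[[[[q1 x] Z] q2] g] d]; rewrite mem_filter => /andP[/= ok_x tr] -> /=.
case def_d: (move_of_int d) => [b|]; case: x ok_x tr => [a /eqP-> tr|[] _ tr] /=.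
- move=> c; apply: (coded_step tr (onth_letter a0 lt_i)) c.
    by rewrite def_d; case: (b).
  by case: (b) => /=; lia.
- case: b def_d => // def_d [eq_i c] /=; rewrite eq_i.
  by apply: (coded_step tr (onth_rmark w)) c; rewrite ?def_d //; lia.
- case: b def_d => // def_d [-> c] /=.
  by apply: (coded_step tr (onth_lmark w)) c; rewrite ?def_d.
- by move=> c; apply: (coded_step tr (onth_letter a0 lt_i)) c; rewrite ?def_d //; lia.
- move=> [eq_i c]; split=> //.
  by apply: (coded_step tr (onth_rmark w)) c; rewrite ?def_d //; lia.
- move=> [eq_i c]; split=> //.
  by apply: (coded_step tr (onth_lmark w)) c; rewrite ?def_d //; lia.
Qed.

(* The weakest precondition of what remains of a program. *)
Fixpoint pending (i : nat) (s : seq uletter) (v : seq bool) : Prop :=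
  match s with
  | Pop b :: s' => forall r, v = b :: r -> pending i s' r
  | Push b :: s' => pending i s' (b :: v)
  | End e :: _ => outcome e i v
  | _ => True
  end.

Lemma pending_program i uv e rest v :
  (forall r, v = uv.1 ++ r -> outcome e i (uv.2 ++ r)) ->
  pending i (program uv ++ End e :: rest) v.
Proof.
case: uv => u x /=; rewrite /program -catA.
elim: u v => [|b u IH] v /= ok_e; last first.
  by move=> r def_v; apply: IH => s def_r; apply: ok_e; rewrite def_v def_r.
have {ok_e}: outcome e i (x ++ v) by apply: ok_e.
(* The last bit of [x] is pushed first, so the induction runs from the right end. *)
elim/last_ind: x v => [|x b IH] v //=; rewrite cat_rcons => /IH.
by rewrite rev_rcons.
Qed.

(** In [InvCross] the head is off the edge facing away from direction [b], so the edge it meets is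
    the exit. The two landing cases cover the cell just past a block, which may be an endmarker: [i]
    is the index just entered in [InvLandRight] and the block just left in [InvLandLeft]. *)
Inductive inv : ustate * nat * seq bool -> Prop :=
| InvBoot : inv (Roam Start, 0, [::])
| InvRoam m i o v of i < size w & o < size (blk i) & configured m i v :
    inv (Roam m, off i + o, v)
| InvExec i o v of i < size w & o < size (blk i) & pending i (drop o (blk i)) v :
    inv (Exec, off i + o, v)
| InvCross i o b v of i < size w & o < size (blk i)
    & (if b then 0 < o else o.+1 < size (blk i)) & coded (target i b) v :
    inv (Cross b, off i + o, v)
| InvLandRight i v of 0 < i <= size w & coded i.+1 v : inv (Cross true, off i, v)
| InvLandLeft i v of i < size w & coded i v : inv (Cross false, (off i).-1, v)
| InvHalt p v of (v = [::] -> accepts A w) : inv (Halt, p, v).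

Lemma inv_step c c' : inv c -> bit_step uinstr utape c c' -> inv c'.
Proof.
have gt1 i : 1 < size (blk i) := size_block (nth a0 w i).
move=> inv_c; move: c'; case: inv_c => {c}.
- apply: (bit_step_ind_at (onth_lmark _)) => q' u v' d r p'.
  rewrite !inE => /eqP[-> -> -> ->] /= <- ->; rewrite -[1]off0 -[off 0]addn0.
  by apply: InvRoam; rewrite // ltnW.
- move=> m i o v lt_i lt_o conf.
  apply: (bit_step_ind_at (onth_utape lt_i lt_o)) => q' u v' d r p'.
  have gt1i := gt1 i.
  have right0 : o.+1 < size (blk i) -> inv (Roam m, off i + o.+1, v).
    by move=> lt_o'; apply: InvRoam.
  have left0 : inv (Roam m, off i + o.-1, v) by apply: InvRoam => //; lia.
  move: (cellP lt_o); rewrite -/(block _) -/(blk i).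
  case def_x: _ / => [o0|o_last|x o_gt0 lt_oS x_in].
  (* Both edges reflect a roaming head, which therefore stays in block [i]. *)
  + rewrite inE => /eqP[-> -> -> ->] /= <- ->.
    by rewrite -addnS; apply: right0; lia.
  + rewrite inE => /eqP[-> -> -> ->] /= <- mv.
    by have -> : p' = off i + o.-1 by lia.
  have {}right0 := right0 lt_oS.
  have roam : (q', (u, v'), d) \in [:: (Roam m, (None, [::]), Some true);
                                       (Roam m, (None, [::]), Some false)] ->
      v = seq_of_opt u ++ r -> moves d (off i + o) p' -> inv (q', p', v' ++ r).
    rewrite !inE => /orP[]/eqP[-> -> -> ->] /= <- mv.
      by rewrite mv -addnS.
    by have -> : p' = off i + o.-1 by lia.
  case: x x_in def_x => [b /(_ b)/eqP //|m' _ def_x|b _ _|b _ _|e _ _]; try exact: roam.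
  rewrite [uinstr _ _]/=; case: eqP => [[eq_m]|_]; last exact: roam.
  rewrite mem_cat => /orP[|]; last exact: roam.
  rewrite inE => /eqP[-> -> -> ->] /= <- ->.
  rewrite -addnS; apply: InvExec => //.
  (* The program entered belongs to an item of this block whose mode is the current one, so
     [item_outcome] supplies its precondition. *)
  have [it [rest [its_it def_m ->]]] := enter_item def_x.
  apply: pending_program => r' def_v; apply: item_outcome => //.
  by rewrite -def_v def_m eq_m.
- move=> i o v lt_i lt_o.
  rewrite (drop_nth (Edge true) lt_o) => pend.
  apply: (bit_step_ind_at (onth_utape lt_i lt_o)) => q' u v' d r p'.
  move: pend; case: (cellP lt_o) => [//|//|[b|m|b|b|[m|b| |]] o_gt0 lt_oS _] //= out;
    rewrite inE => /eqP[-> -> -> ->] /= def_v ->.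
  + by rewrite -addnS; apply: InvExec => //; apply: out.
  + by rewrite -addnS -def_v; apply: InvExec.
  + by rewrite -def_v; apply: InvRoam.
  + by rewrite -def_v; apply: InvCross => //; case: (b).
  + by rewrite -def_v; apply: InvHalt.
- move=> i o b v lt_i lt_o side_o cod.
  apply: (bit_step_ind_at (onth_utape lt_i lt_o)) => q' u v' d r p'.
  have next x : o.+1 < size (blk i) -> 0 < o -> (forall e, x != Edge e) ->
      (q', (u, v'), d) \in uinstr (Cross b) (letter x) ->
      v = seq_of_opt u ++ r -> moves d (off i + o) p' -> inv (q', p', v' ++ r).
    move=> lt_oS o_gt0 x_in.
    have -> : uinstr (Cross b) (letter x) = [:: (Cross b, (None, [::]), Some b)].
      by case: x x_in => // e /(_ e)/eqP.
    rewrite inE => /eqP[-> -> -> ->] /= <-.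
    case: (b) cod => cod mv.
      by rewrite mv -addnS; apply: InvCross.
    have -> : p' = off i + o.-1 by move: mv => /=; lia.
    by apply: InvCross => //; lia.
  case: (cellP lt_o) next => [o0|o_last|x o_gt0 lt_oS x_in] next; last exact: next.
  + case: b side_o cod {next} => side_o cod; first by rewrite o0 in side_o.
    rewrite inE => /eqP[-> -> -> ->] /= <- mv.
    have -> : p' = (off i).-1 by lia.
    exact: InvLandLeft.
  + case: b side_o cod {next} => side_o cod; last by rewrite o_last ltnn in side_o.
    rewrite inE => /eqP[-> -> -> ->] /= <- ->.
    rewrite -addnS o_last -(offS lt_i).
    exact: InvLandRight.
(* At the right endmarker the head turns back to the last cell of the last block and records the
   endmarker in its mode; otherwise it is on the left edge of block [i]. *)
- move=> i v /andP[i_gt0]; rewrite leq_eqVlt => /predU1P[->|lt_i] cod.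
    rewrite off_size; apply: (bit_step_ind_at (onth_rmark _)) => q' u v' d r p'.
    rewrite inE => /eqP[-> -> -> ->] /= <-; rewrite -off_size => mv.
    have lt_i : (size w).-1 < size w by lia.
    have := offS lt_i; rewrite prednK // => def_off.
    have gt1i := gt1 (size w).-1.
    have -> : p' = off (size w).-1 + (size (blk (size w).-1)).-1 by lia.
    by apply: InvRoam; rewrite /= ?prednK //; lia.
  have lt_0 : 0 < size (blk i) by apply: ltnW.
  rewrite -[off i]addn0; apply: (bit_step_ind_at (onth_utape lt_i lt_0)).
  move=> q' u v' d r p'; rewrite inE => /eqP[-> -> -> ->] /= <- ->.
  exact: InvRoam.
- case=> [|i] v lt_i cod.
    rewrite off0; apply: (bit_step_ind_at (onth_lmark _)) => q' u v' d r p'.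
    rewrite inE => /eqP[-> -> -> ->] /= <- ->; rewrite -[1]off0 -[off 0]addn0.
    by apply: InvRoam; rewrite // ltnW.
  have lt_i' : i < size w by apply: ltnW.
  have gt1i := gt1 i; rewrite (offS lt_i').
  have -> : (off i + size (blk i)).-1 = off i + (size (blk i)).-1 by lia.
  have lt_o : (size (blk i)).-1 < size (blk i) by lia.
  apply: (bit_step_ind_at (onth_utape lt_i' lt_o)) => q' u v' d r p'.
  rewrite nth_last /= last_rcons inE => /eqP[-> -> -> ->] /= <- ->.
  exact: InvRoam.
- move=> p v acc c' st; move: {-2}(Halt, p, v) (erefl (Halt, p, v)) st => c + st.
  case: st => q1 p1 v1 q2 p2 v2 r a u m _ + def_v _ _ [eq_q _ eq_v].
  rewrite eq_q; case: a => //= _; rewrite inE => /eqP[-> eq_u -> _].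
  by apply: InvHalt; rewrite /= -eq_v def_v eq_u in acc *.
Qed.

Lemma accepts_of_universal : accepts universal (encode w) -> accepts A w.
Proof.
move=> /accepts_bit_machine[q /set1P-> runs].
have {}runs := clos_rt_rtn1 _ _ _ _ runs.
have : inv (Halt, (size (encode w)).+1, [::]).
  elim: runs => [|c c' st _ inv_c]; first exact: InvBoot.
  exact: inv_step inv_c st.
move: {-2}(Halt, _, _) (erefl (Halt, (size (encode w)).+1, [::] : seq bool)) => c + inv_c.
by case: inv_c => // p v acc [_ v0]; apply: acc.
Qed.


(** * Completeness: simulating the runs of the given automaton *)

Definition uruns := clos_refl_trans _ (bit_step uinstr utape).

Lemma uruns_trans c1 c2 c3 : uruns c1 c2 -> uruns c2 c3 -> uruns c1 c3.
Proof. exact: rt_trans. Qed.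

Lemma uruns_keep q p v a q' m p' :
  onth utape p = Some a -> (q', (None, [::]), m) \in uinstr q a ->
  moves m p p' -> p' < size utape -> uruns (q, p, v) (q', p', v).
Proof.
by move=> ta qm mv lt_p'; apply: rt_step; apply: (BitStep (v' := [::]) ta qm).
Qed.

Lemma uinstr_roam m b x : x != Edge b ->
  (Roam m, (None, [::]), Some b) \in uinstr (Roam m) (letter x).
Proof.
case: x => [e|m'|e|e|e] /=; try by case: b; rewrite !inE eqxx ?orbT.
  by rewrite inE; case: e b => [] []; rewrite ?eqxx.
by rewrite mem_cat; case: b; rewrite !inE eqxx ?orbT.
Qed.

Lemma roam_left m i o v : i < size w -> o < size (blk i) ->
  uruns (Roam m, off i + o, v) (Roam m, off i + 0, v).
Proof.
move=> lt_i; elim: o => [|o IH] lt_o; first exact: rt_refl.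
apply: uruns_trans (IH (ltnW lt_o)).
apply: (uruns_keep _ (onth_utape lt_i lt_o) (m := Some false)).
- by case: (cellP lt_o) => [//|_|x _ _ x_in]; apply: uinstr_roam.
- by rewrite /= addnS.
- exact: lt_utape (ltnW lt_o).
Qed.

Lemma roam_right m i o v : i < size w -> o < size (blk i) ->
  uruns (Roam m, off i + 0, v) (Roam m, off i + o, v).
Proof.
move=> lt_i; elim: o => [|o IH] lt_o; first exact: rt_refl.
apply: uruns_trans (IH (ltnW lt_o)) _.
apply: (uruns_keep _ (onth_utape lt_i (ltnW lt_o)) (m := Some true)).
- case: (cellP (ltnW lt_o)) => [_|o_last|x _ _ x_in]; try exact: uinstr_roam.
  by move: lt_o; rewrite o_last ltnn.
- by rewrite /= addnS.
- exact: lt_utape.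
Qed.

Lemma drop_cons (T : Type) (x0 x : T) o s s' : drop o s = x :: s' ->
  [/\ o < size s, nth x0 s o = x & drop o.+1 s = s'].
Proof.
case: (ltnP o (size s)) => [lt_o|le_o]; last by rewrite drop_oversize.
by rewrite (drop_nth x0 lt_o) => -[-> ->].
Qed.

Lemma run_program i o uv e rest r : i < size w ->
  drop o (blk i) = program uv ++ End e :: rest ->
  exists o', [/\ o' < size (blk i), nth (Edge true) (blk i) o' = End e
    & uruns (Exec, off i + o, uv.1 ++ r) (Exec, off i + o', uv.2 ++ r)].
Proof.
case: uv => u x lt_i; rewrite /program -catA /=.
elim: u o => [|b u IH] o /= def_o.
  (* The induction is on the word in the order in which it is pushed. *)
  rewrite -(revK x); elim: (rev x) o r def_o => [|b y IH] o r /= def_o.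
    have [lt_o def_e _] := drop_cons (Edge true) def_o.
    by exists o; split=> //; apply: rt_refl.
  have [lt_o def_b def_oS] := drop_cons (Edge true) def_o.
  have [o' [lt_o' def_e runs]] := IH _ (b :: r) def_oS.
  exists o'; split=> //; rewrite rev_cons cat_rcons; apply: uruns_trans runs.
  apply: rt_step; apply: (BitStep (u := None) (v' := [:: b]) (m := Some true)).
  - exact: onth_utape.
  - by rewrite def_b inE.
  - by [].
  - by rewrite /= addnS.
  (* The rest of the program still contains [End e], so the next cell is in the block. *)
  - apply: lt_utape => //; rewrite ltnNge; apply: contra_eqN def_oS => /drop_oversize->.
    by case: (y).
have [lt_o def_b def_oS] := drop_cons (Edge true) def_o.
have [o' [lt_o' def_e runs]] := IH _ def_oS.
exists o'; split=> //; apply: uruns_trans runs.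
apply: rt_step; apply: (BitStep (u := Some b) (v' := [::]) (m := Some true)).
- exact: onth_utape.
- by rewrite def_b inE.
- by [].
- by rewrite /= addnS.
- apply: lt_utape => //; rewrite ltnNge; apply: contra_eqN def_oS => /drop_oversize->.
  by case: (u) => //; case: (rev x).
Qed.

(** The head returns to the left edge, walks right to the [Enter] of the item, and runs its
    program. *)
Lemma run_item i it o r :
  i < size w -> o < size (blk i) -> it \in items (nth a0 w i) ->
  exists o', [/\ o' < size (blk i), nth (Edge true) (blk i) o' = End it.2
    & uruns (Roam it.1.1, off i + o, it.1.2.1 ++ r)
            (Exec, off i + o', it.1.2.2 ++ r)].
Proof.
move=> lt_i lt_o /item_offset[o1 [rest [lt_o1 def_o1]]].
rewrite /item_word cat_cons cat_rcons in def_o1.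
have [_ def_x def_oS] := drop_cons (Edge true) def_o1.
have [o' [lt_o' def_e runs]] := run_program r lt_i def_oS.
exists o'; split=> //; apply: uruns_trans runs.
apply: uruns_trans (roam_left _ _ lt_i lt_o) _.
apply: uruns_trans (roam_right _ _ lt_i lt_o1) _.
apply: (uruns_keep _ (onth_utape lt_i lt_o1) (m := Some true)).
- by rewrite [nth _ _ _]def_x /= eqxx inE.
- by rewrite /= addnS.
- apply: lt_utape => //; rewrite ltnNge; apply: contra_eqN def_oS => /drop_oversize->.
  by case: (program _).
Qed.

Lemma cross_right i o v : i < size w -> 0 < o < size (blk i) ->
  uruns (Cross true, off i + o, v) (Cross true, off i.+1, v).
Proof.
move=> lt_i; move def_k: (size (blk i) - o) => k.
elim: k o def_k => [|k IH] o def_k /andP[o_gt0 lt_o]; first by lia.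
have step_right p' : p' = off i + o.+1 -> p' < size utape ->
    uruns (Cross true, off i + o, v) (Cross true, p', v).
  move=> -> lt_p'.
  apply: (uruns_keep _ (onth_utape lt_i lt_o) (m := Some true)) => //=.
    case: (cellP lt_o) => [o0|_|x _ _ x_in]; first by rewrite o0 in o_gt0.
      by rewrite inE.
    by case: x x_in => [e /(_ e)/eqP//|m|e|e|e] _; rewrite inE.
  by rewrite addnS.
case: (ltngtP o.+1 (size (blk i))) => [lt_oS|gt_oS|eq_oS]; last 1 first.
- apply: step_right; first by rewrite offS // eq_oS.
  (* The cell after the block is the left edge of the next block or the right endmarker. *)
  case: (ltngtP i.+1 (size w)) => [lt_iS|gt_iS|->]; first 1 last.
  + by move: gt_iS; rewrite ltnS leqNgt lt_i.
  + by rewrite -onthTE off_size onth_rmark.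
  + by rewrite -[off _]addn0; apply: lt_utape.
- by apply: uruns_trans (step_right _ erefl _) (IH _ _ _); rewrite ?lt_utape //; lia.
- by lia.
Qed.

Lemma cross_left i o v : i < size w -> o.+1 < size (blk i) ->
  uruns (Cross false, off i + o, v) (Cross false, (off i).-1, v).
Proof.
move=> lt_i; elim: o => [|o IH] lt_o.
  apply: (uruns_keep _ (onth_utape lt_i (ltnW lt_o)) (m := Some false)) => //=.
    by rewrite addn0.
  by apply: leq_trans (lt_utape lt_i (ltnW lt_o)); rewrite addn0.
apply: uruns_trans (IH (ltnW lt_o)).
apply: (uruns_keep _ (onth_utape lt_i (ltnW lt_o)) (m := Some false)).
- case: (cellP (ltnW lt_o)) => [//|o_last|x _ _ x_in].
    by rewrite o_last ltnn in lt_o.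
  by case: x x_in => [e /(_ e)/eqP//|m|e|e|e] _; rewrite inE.
- by rewrite /= addnS.
- exact: lt_utape (ltnW (ltnW lt_o)).
Qed.

(** The pairs of a mode and a block that represent head position [j] of [A]. In mode [Start] no
    configuration of [A] is represented yet. *)
Definition located (m : mode) (i j : nat) : Prop :=
  match m with
  | Start => False
  | Inside => j = i.+1
  | Outside b => i = (if b then (size w).-1 else 0)
                 /\ j = (if b then (size w).+1 else 0)
  end.

Definition ready (j : nat) (v : seq bool) : Prop :=
  exists m i o, [/\ i < size w, o < size (blk i), located m i j
    & uruns (Roam Start, 0, [::]) (Roam m, off i + o, v)].

Lemma ready_leave i o b v : i < size w -> o < size (blk i) ->
  nth (Edge true) (blk i) o = End (Leave b) ->
  uruns (Roam Start, 0, [::]) (Exec, off i + o, v) ->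
  ready (target i b) v.
Proof.
move=> lt_i lt_o def_o runs.
have {}runs : uruns (Roam Start, 0, [::]) (Cross b, off i + o, v).
  apply: uruns_trans runs _.
  apply: (uruns_keep _ (onth_utape lt_i lt_o) (m := None)); rewrite ?lt_utape //.
  by rewrite def_o inE.
have gt1 k : 1 < size (blk k) := size_block (nth a0 w k).
(* An [End] letter is interior, so a crossing starts off both edges. *)
have [o_gt0 lt_oS] : 0 < o /\ o.+1 < size (blk i).
  by move: def_o; case: (cellP lt_o).
case: b def_o runs => _ runs.
  have {}runs := uruns_trans runs (cross_right v lt_i (introT andP (conj o_gt0 lt_o))).
  case: (ltngtP i.+1 (size w)) => [lt_iS|gt_iS|eq_iS].
  - exists Inside, i.+1, 0; split; rewrite // ?(ltnW (gt1 _)) //.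
    rewrite -[off i.+1]addn0 in runs; apply: uruns_trans runs _.
    have lt_0 : 0 < size (blk i.+1) by apply: ltnW.
    apply: (uruns_keep _ (onth_utape lt_iS lt_0) (m := None)); rewrite ?lt_utape //.
  - by move: gt_iS; rewrite ltnS leqNgt lt_i.
  have def_n : (size w).-1 = i by rewrite -eq_iS.
  have lt_l : (size (blk i)).-1 < size (blk i) by rewrite prednK // ltnW.
  exists (Outside true), i, (size (blk i)).-1; split=> //; first by rewrite /= def_n eq_iS.
  apply: uruns_trans runs _; rewrite eq_iS off_size.
  apply: (uruns_keep _ (onth_rmark _) (m := Some false)); rewrite ?lt_utape //.
  by rewrite /moves -off_size -eq_iS offS //; have := gt1 i; lia.
have {}runs := uruns_trans runs (cross_left v lt_i lt_oS).
case: i lt_i {lt_o o_gt0 lt_oS} runs => [|i] lt_i runs.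
  exists (Outside false), 0, 0; split; rewrite // ?(ltnW (gt1 _)) //.
  rewrite off0 in runs; apply: uruns_trans runs _.
  have lt_0 : 0 < size (blk 0) by apply: ltnW.
  apply: (uruns_keep _ (onth_lmark _) (m := Some true)); rewrite ?lt_utape //.
  by rewrite off0.
have lt_i' : i < size w by apply: ltnW.
have lt_l : (size (blk i)).-1 < size (blk i) by rewrite prednK // ltnW.
exists Inside, i, (size (blk i)).-1; split=> //.
apply: uruns_trans runs _; rewrite offS //.
have -> : (off i + size (blk i)).-1 = off i + (size (blk i)).-1.
  by have := gt1 i; lia.
apply: (uruns_keep _ (onth_utape lt_i' lt_l) (m := None)); rewrite ?lt_utape //.
by rewrite nth_last /= last_rcons inE.
Qed.

Lemma ready_goto m i j o v : i < size w -> o < size (blk i) ->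
  nth (Edge true) (blk i) o = End (Goto m) -> located m i j ->
  uruns (Roam Start, 0, [::]) (Exec, off i + o, v) -> ready j v.
Proof.
move=> lt_i lt_o def_o loc runs; exists m, i, o; split=> //.
apply: uruns_trans runs _.
apply: (uruns_keep _ (onth_utape lt_i lt_o) (m := None)); rewrite ?lt_utape //.
by rewrite def_o inE.
Qed.

(** This ensures that the item of any transition applicable at [j] is present in block [i] and can
    be entered in mode [m]. *)
Lemma onth_located m i j x :
  i < size w -> located m i j -> onth tape j = Some x ->
  m = zone x /\ (if x is inl a then a = nth a0 w i else true).
Proof.
move=> lt_i; case: m => [//|->|[] [_ ->]].
- by rewrite /tape (onth_letter a0) // => -[<-].
- by rewrite /tape onth_rmark => -[<-].
- by rewrite /tape onth_lmark => -[<-].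
Qed.

Lemma ready_step q1 x Z q2 g d j j' r :
  (q1, x, Z, q2, g, d) \in delta A -> onth tape j = Some x ->
  moves (move_of_int d) j j' -> j' < (size w).+2 ->
  ready j (enc q1 [:: Z] ++ r) -> ready j' (enc q2 g ++ r).
Proof.
move=> tr tx mv lt_j' [m [i [o [lt_i lt_o loc runs]]]].
have [def_m x_i] := onth_located lt_i loc tx.
have it_in : transition_item (q1, x, Z, q2, g, d) \in items (nth a0 w i).
  rewrite inE mem_cat; apply/orP; right; apply/orP; right.
  apply/mapP; exists (q1, x, Z, q2, g, d) => //; rewrite mem_filter tr andbT /=.
  by case: (x) x_i => // a ->.
have [o' [lt_o' def_e]] := run_item r lt_i lt_o it_in.
rewrite /= -def_m => /(uruns_trans runs) {}runs; rewrite /= in def_e.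
case: x def_m def_e {tr tx x_i it_in} => [a|b] def_m def_e; rewrite /= in def_m.
  rewrite {}def_m /= in loc; rewrite {}loc in mv.
  case: (move_of_int d) mv def_e => [b|] mv def_e.
    have -> : j' = target i b by case: (b) mv => /= mv; lia.
    exact: ready_leave def_e runs.
  by apply: ready_goto def_e _ runs => //; rewrite mv.
rewrite {}def_m /= in loc; case: loc => def_i def_j; rewrite {}def_j in mv.
case: (move_of_int d) mv def_e => [b'|] mv def_e; last first.
  by apply: ready_goto def_e _ runs => //; rewrite mv.
(* An outward move from an endmarker would leave the tape, which the bounds on [j'] exclude; an
   inward one ends at the position of the adjacent block. *)
rewrite /= in def_e; case: (b =P b') def_e => [eq_b|ne_b] def_e.
  by case: b b' mv eq_b {def_i def_e} => [] [] //= mv; lia.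
apply: ready_goto def_e _ runs => //.
by case: b b' mv ne_b def_i => [] [] //= mv _ ->; lia.
Qed.

Lemma ready_start : ready 0 (enc (init A) [:: bottom A]).
Proof.
have lt_0 : 0 < size (blk 0) by apply: ltnW; apply: size_block.
have runs : uruns (Roam Start, 0, [::]) (Roam Start, off 0 + 0, [::]).
  apply: (uruns_keep _ (onth_lmark _) (m := Some true)); rewrite ?lt_utape //=.
  by rewrite off0.
pose it : item := (Start, ([::], enc (init A) [:: bottom A]), Goto (Outside false)).
have it_in : it \in items (nth a0 w 0) by rewrite mem_head.
have [o [lt_o def_e]] := run_item [::] w_gt0 lt_0 it_in.
rewrite /= cats0 => /(uruns_trans runs){}runs.
exact: ready_goto def_e _ runs.
Qed.

Lemma ready_reach q j g : reach (q, j, g) -> ready j (enc q g).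
Proof.
move=> runs; pose P (c : config A) := ready c.1.2 (enc c.1.1 c.2).
suff: P (q, j, g) by [].
have {runs} := clos_rt_rtn1 _ _ _ _ runs.
elim=> [|c c' st _]; first exact: ready_start.
case: st => q1 a Z q2 g' d i k r tr ta lt_k def_k; rewrite /P /= => ready_i.
(* The bits left untouched are the codes of the stack below the symbol read. *)
have := @ready_step q1 a Z q2 g' d i k (flatten (map (@code _) r)) tr ta.
rewrite /enc map_cat flatten_cat /= cats0 -!catA; apply=> //.
  by apply/moves_int; rewrite move_of_intK // (delta_move tr).
by rewrite -size_tape.
Qed.

Lemma run_halt p v : 0 < p <= (size (encode w)).+1 ->
  uruns (Halt, p, v) (Halt, (size (encode w)).+1, v).
Proof.
move def_k: ((size (encode w)).+1 - p) => k; elim: k p def_k => [|k IH] p def_k.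
  move=> /andP[_ le_p]; have -> : p = (size (encode w)).+1 by lia.
  exact: rt_refl.
case: p def_k => [//|p] def_k /andP[_ le_p].
have lt_p : p < size (encode w) by lia.
have lt_S : p.+2 < size utape by rewrite size_tape !ltnS.
apply: uruns_trans (IH p.+2 _ _); [|by lia|by []].
by apply: (uruns_keep _ (onth_letter (Edge true) lt_p) (m := Some true)).
Qed.

Lemma universal_of_accepts : accepts A w -> accepts universal (encode w).
Proof.
case=> q Fq /ready_reach[m [i [o [lt_i lt_o loc runs]]]].
apply/accepts_bit_machine; exists Halt; first exact: set11.
(* Scanning the right endmarker forces mode [Outside true], in which the accepting programs can be
   entered. *)
have [def_m _] := onth_located lt_i loc (onth_rmark w).
rewrite def_m /= in runs loc.
pose it : item := (Outside true, (enc q [:: bottom A], [::]), Finish).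
have it_in : it \in items (nth a0 w i).
  rewrite inE mem_cat; apply/orP; right; apply/orP; left.
  by apply/mapP; exists q; rewrite // mem_enum.
have [o' [lt_o' def_e]] := run_item [::] lt_i lt_o it_in.
rewrite /= cats0 => /(uruns_trans runs){}runs; apply: uruns_trans runs _.
have lt_oS : o'.+1 < size (blk i) by move: def_e; case: (cellP lt_o').
apply: uruns_trans (run_halt (p := (off i + o').+1) _ _).
  apply: (uruns_keep _ (onth_utape lt_i lt_o') (m := Some true)) => //.
    by rewrite def_e inE.
  by rewrite -addnS lt_utape.
by rewrite /= -ltnS -(size_tape (encode w)) -addnS lt_utape.
Qed.

End Simulation.

Theorem theorem21 :
  exists (Sigma0 : finType) (A0 : npda2 Sigma0),
    forall (Sigma : finType) (A : npda2 Sigma),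
      exists h : seq Sigma -> seq Sigma0,
        word_morphism h /\
        forall w : seq Sigma, w <> [::] -> (accepts A w <-> accepts A0 (h w)).
Proof.
exists uletter, universal => Sigma A; exists (encode A); split.
  by move=> u v; rewrite /encode map_cat flatten_cat.
(* The first letter serves as the default value of [nth]. *)
case=> // a w _; split.
  exact: (@universal_of_accepts _ A a (a :: w)).
exact: (@accepts_of_universal _ A a (a :: w)).
Qed.
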